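(* Consider the linear time-invariant discrete-time system with unknown inputs described in the context (with $w_k=0$, $v_k=0$, $B=0$, $D=0$). The system is strongly observable (input and state observable) if and only if $$\mathrm{rk}\begin{bmatrix}\mathcal{O}_{2,\tilde n}&\mathcal{I}_{(2,2),\tilde n}\end{bmatrix}=n+\tilde n(p-p_H)\qquad( * )$$ for some $0\le\tilde n\le n$. Moreover, if $l\ne p$, then $r_0\le\tilde n\le n$, where $r_0:=\left\lceil\frac{n-l-p_H}{l-p}\right\rceil$; otherwise, $l=p=n$ and $p_H=0$ must hold. Necessary conditions for $( * )$ to hold when $\tilde n=n$ are: (I) either $r\ge r_0$ (with horizon $r=\tilde n=n$) and $l\ge p+1$, or $l=p=n$ and $p_H=0$; (II)(a) $\mathrm{rk}(\mathcal{O}_{2,n-1})=n$, and thus $(\hat A,C)$ is observable; and (b) $\mathrm{rk}(C_2G_2)=p-p_H$, and thus $\mathrm{rk}(CG)\ge p-p_H$.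
   Context: System: $x_{k+1}=Ax_k+Bu_k+Gd_k+w_k$, $y_k=Cx_k+Du_k+Hd_k+v_k$, $k\ge0$, with state $x_k\in\mathbb{R}^n$, known input $u_k\in\mathbb{R}^m$, unknown arbitrary input $d_k\in\mathbb{R}^p$, measurement $y_k\in\mathbb{R}^l$. The noise covariances are $Q\succeq0$ (of $w_k$) and $R\succ0$ (of $v_k$); for observability questions the noises and the known inputs are set to zero and $R$ enters only through $T_1$ below. Standing assumptions: $n\ge l\ge1$, $l\ge p\ge0$, $m\ge 0$, $\mathrm{rk}[G^\top\ H^\top]=p$. No assumption is made on the rank of $H$. Transformation: $p_H:=\mathrm{rk}(H)$; singular value decomposition $H=\begin{bmatrix}U_1&U_2\end{bmatrix}\begin{bmatrix}\Sigma&0\\ 0&0\end{bmatrix}\begin{bmatrix}V_1^\top\\ V_2^\top\end{bmatrix}$ with $\Sigma\in\mathbb{R}^{p_H\times p_H}$ diagonal of full rank, $[U_1\ U_2]$ and $[V_1\ V_2]$ unitary. Put $d_{1,k}=V_1^\top d_k$, $d_{2,k}=V_2^\top d_k$, $G_1=GV_1$, $G_2=GV_2$, $T_1=U_1^\top-U_1^\top RU_2(U_2^\top RU_2)^{-1}U_2^\top$, $C_1=T_1C$, $C_2=U_2^\top C$, and $\hat A:=A-G_1\Sigma^{-1}C_1$. Operations with empty matrices are allowed (the inverse of an empty matrix is empty). $\mathcal{O}_{2,r}$ is the stack of $C_2,C_2\hat A,\dots,C_2\hat A^r$. $\mathcal{I}_{(2,2),r}$ is the block matrix with block rows $i=0,\dots,r$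 and block columns $j=0,\dots,r-1$ whose $(i,j)$ block is $0$ for $i\le j$ and $C_2\hat A^{i-j-1}G_2$ for $i>j$. Strong observability: the system is strongly observable (equivalently, state and input observable) if $x_0$ and the unknown input vector $\mathcal{D}_r$, consisting of $d_{1,0},\dots,d_{1,r}$ and $d_{2,0},\dots,d_{2,r-1}$, can be uniquely determined from the measured outputs $y_0,\dots,y_r$ for a large enough number of observations, i.e. for $r\ge r_0'$ for some $r_0'\in\mathbb{N}$. $\lceil a\rceil$ is the smallest integer not less than $a$. *)

(* Defs.v *)
From HB Require Import structures.
From mathcomp Require Import all_boot all_order all_algebra.
From mathcomp Require Import reals.

Set Implicit Arguments.
Unset Strict Implicit.
Unset Printing Implicit Defensive.

Import Order.TTheory GRing.Theory Num.Theory.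

Local Open Scope ring_scope.

Definition posdefmx (R : realType) (m : nat) (M : 'M[R]_m) : Prop :=
  M^T = M /\ forall x : 'cV[R]_m, x != 0 -> 0 < (x^T *m M *m x) 0 0.

(* [row_mx X1 X2] is square only up to a provable equality of its dimensions,
   hence both one-sided orthogonality equations. *)
Definition unitary_cols (R : realType) (m a b : nat)
    (X1 : 'M[R]_(m, a)) (X2 : 'M[R]_(m, b)) : Prop :=
  (row_mx X1 X2)^T *m row_mx X1 X2 = 1%:M /\
  row_mx X1 X2 *m (row_mx X1 X2)^T = 1%:M.

(* No sign or ordering condition is put on the diagonal of [S], so every
   singular value decomposition of [H] is an instance. *)
Definition is_svd (R : realType) (l p : nat) (H : 'M[R]_(l, p))
    (U1 : 'M[R]_(l, \rank H)) (U2 : 'M[R]_(l, l - \rank H))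
    (S : 'M[R]_(\rank H))
    (V1 : 'M[R]_(p, \rank H)) (V2 : 'M[R]_(p, p - \rank H)) : Prop :=
  [/\ unitary_cols U1 U2, unitary_cols V1 V2,
      is_diag_mx S, \rank S = \rank H
    & H = row_mx U1 U2 *m block_mx S 0 0 0 *m col_mx V1^T V2^T].

(* The [T_1] of the output transformation, for the measurement noise
   covariance [Rv]. *)
Definition decoupling_mx (R : realType) (l a b : nat) (Rv : 'M[R]_l)
    (U1 : 'M[R]_(l, a)) (U2 : 'M[R]_(l, b)) : 'M[R]_(a, l) :=
  U1^T - U1^T *m Rv *m U2 *m invmx (U2^T *m Rv *m U2) *m U2^T.

Fixpoint state (R : realType) (n p : nat) (A : 'M[R]_n) (G : 'M[R]_(n, p))
    (x0 : 'cV[R]_n) (d : nat -> 'cV[R]_p) (k : nat) : 'cV[R]_n :=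
  if k is k'.+1 then A *m state A G x0 d k' + G *m d k' else x0.

Definition output (R : realType) (n p l : nat)
    (A : 'M[R]_n) (G : 'M[R]_(n, p)) (C : 'M[R]_(l, n)) (H : 'M[R]_(l, p))
    (x0 : 'cV[R]_n) (d : nat -> 'cV[R]_p) (k : nat) : 'cV[R]_l :=
  C *m state A G x0 d k + H *m d k.

(* The components V1^T d_k are to be recovered up to time r, but V2^T d_k only
   up to time r - 1: the latter reach the output with one step of delay. *)
Definition strongly_observable (R : realType) (n p l a b : nat)
    (A : 'M[R]_n) (G : 'M[R]_(n, p)) (C : 'M[R]_(l, n)) (H : 'M[R]_(l, p))
    (V1 : 'M[R]_(p, a)) (V2 : 'M[R]_(p, b)) : Prop :=
  exists r0' : nat, forall r : nat, (r0' <= r)%N ->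
    forall (x0 x0' : 'cV[R]_n) (d d' : nat -> 'cV[R]_p),
      (forall k, (k <= r)%N ->
         output A G C H x0 d k = output A G C H x0' d' k) ->
      [/\ x0 = x0',
          forall k, (k <= r)%N -> V1^T *m d k = V1^T *m d' k
        & forall k, (k < r)%N -> V2^T *m d k = V2^T *m d' k].

Definition observable (R : realType) (n l : nat)
    (A : 'M[R]_n) (C : 'M[R]_(l, n)) : Prop :=
  exists r : nat, forall x0 x0' : 'cV[R]_n,
    (forall k, (k <= r)%N -> C *m A ^+ k *m x0 = C *m A ^+ k *m x0') ->
    x0 = x0'.

Definition obsv_mx (R : realType) (n c : nat)
    (C : 'M[R]_(c, n)) (A : 'M[R]_n) (r : nat) :=
  \mxcol_(i < r.+1) (C *m A ^+ i).

Definition input_mx (R : realType) (n c q : nat)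
    (C : 'M[R]_(c, n)) (A : 'M[R]_n) (G : 'M[R]_(n, q)) (r : nat) :=
  \mxblock_(i < r.+1, j < r)
    (if (j < i)%N then C *m A ^+ (i - j - 1) *m G else 0).

(* Main.v *)
Require Import Defs.
From HB Require Import structures.
From mathcomp Require Import all_boot all_order all_algebra.
From mathcomp Require Import reals.
From mathcomp Require Import zify lra.

Set Implicit Arguments.
Unset Strict Implicit.
Unset Printing Implicit Defensive.

Import Order.TTheory GRing.Theory Num.Theory.

Local Open Scope ring_scope.

(** A vanishing measurement [y_k = C x_k + H d_k = 0] splits into two
    conditions: [C2 x_k = 0], and the value [- Sigma^-1 C1 x_k] for the
    component [V1^T d_k].  Substituting that value turns the dynamics into
    [x_(k+1) = Ahat x_k + G2 (V2^T d_k)].  By linearity, strong observability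
    therefore says that for all large horizons [r] the triple [(C2, Ahat, G2)]
    has no nonzero initial state and inputs [d_0, ..., d_(r-1)] with zero output
    up to time [r] ([strongly_observableP]).  The matrix of the map that sends
    initial state and inputs to that output is [[O_r  I_r]], so the property at
    horizon [r] is exactly the rank condition ([obsv_input_full_rankP]).

    It remains to compare horizons.  Going up is a shift of time
    ([zero_output_trivialS]): if both the trajectory and its tail satisfy the
    property at [r], only [d_0] is left, and [G2 d_0 = 0] forces [d_0 = 0]
    because [[G; H]] has full column rank.  Going down to [n] is the essential
    point.  For a positive horizon an input at the last instant alone shows that
    [C2 G2] is injective, say with left inverse [L].  Then an output-nulling
    input must be the state feedback [- L C2 Ahat x_k], so the property at [r]
    says that [C2 F^k x = 0] for all [k <= r] implies [x = 0], where
    [F = Ahat - G2 L C2 Ahat] ([zero_output_trivial_feedbackP]).  This is plain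
    observability, for which [n] samples suffice by Cayley-Hamilton.

    The bounds on the horizon come from comparing the number of rows with the
    number of columns.  The remaining necessary conditions are zero input
    (observability of [(Ahat, C2)]) and a single input at the last instant
    (injectivity of [C2 G2]). *)

(** * Full column rank *)

Lemma full_col_rankP (F : fieldType) (m k : nat) (M : 'M[F]_(m, k)) :
  \rank M = k <-> forall v : 'cV_k, M *m v = 0 -> v = 0.
Proof.
rewrite -mxrank_tr; split=> [rkM v Mv0 | inj].
  have freeM : row_free M^T by rewrite /row_free rkM.
  apply: trmx_inj; apply/eqP; rewrite trmx0 -(mulmx_free_eq0 _ freeM).
  by rewrite -trmx_mul Mv0 trmx0.
apply/eqP; rewrite -[_ == k]/(row_free M^T) -kermx_eq0; apply/rowV0P => v.
move=> /sub_kermxP vM0; rewrite -[v]trmxK (inj v^T) ?trmx0 //.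
by rewrite -[M]trmxK -trmx_mul vM0 trmx0.
Qed.

Lemma full_col_rank_linv (F : fieldType) (m k : nat) (M : 'M[F]_(m, k)) :
  \rank M = k -> exists L, L *m M = 1%:M.
Proof.
rewrite -mxrank_tr => /eqP/row_freeP[B MB1].
by exists B^T; rewrite -[M]trmxK -trmx_mul MB1 trmx1.
Qed.

(** * Trajectories and output-nulling inputs *)

Lemma state_sum (R : realType) (n q : nat) (A : 'M[R]_n) (G : 'M[R]_(n, q))
    x0 d k :
  state A G x0 d k
    = A ^+ k *m x0 + \sum_(j < k) A ^+ (k - j - 1) *m G *m d j.
Proof.
elim: k => [|k IHk] /=; first by rewrite big_ord0 addr0 expr0 mul1mx.
rewrite IHk mulmxDr big_ord_recr /= mulmx_sumr exprS -mulmxE -mulmxA.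
rewrite subSn // subnn subn1 expr0 mul1mx addrA; congr (_ + _ + _).
apply: eq_bigr => j _; rewrite !mulmxA; congr (_ *m _ *m _).
rewrite [in RHS](_ : (k.+1 - j - 1 = (k - j - 1).+1)%N) ?exprS //.
by have := ltn_ord j; lia.
Qed.

Lemma stateB (R : realType) (n q : nat) (A : 'M[R]_n) (G : 'M[R]_(n, q))
    x0 x0' d d' k :
  state A G (x0 - x0') (fun j => d j - d' j) k
    = state A G x0 d k - state A G x0' d' k.
Proof. by elim: k => //= k ->; rewrite !mulmxBr opprD addrACA. Qed.

Lemma state_shift (R : realType) (n q : nat) (A : 'M[R]_n) (G : 'M[R]_(n, q))
    x0 d k :
  state A G x0 d k.+1 = state A G (A *m x0 + G *m d 0) (fun j => d j.+1) k.
Proof. by elim: k => //= k <-. Qed.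

Lemma state0 (R : realType) (n q : nat) (A : 'M[R]_n) (G : 'M[R]_(n, q)) d k :
  (forall j, (j < k)%N -> d j = 0) -> state A G 0 d k = 0.
Proof.
elim: k => //= k IHk d0; rewrite IHk ?d0 ?mulmx0 ?addr0 //.
by move=> j /ltnW; apply: d0.
Qed.

(** Only the inputs strictly before time [r] are required to vanish: without
    feedthrough, [d r] does not reach the outputs up to time [r]. *)
Definition zero_output_trivial (R : realType) (c n q : nat) (C : 'M[R]_(c, n))
    (A : 'M[R]_n) (G : 'M[R]_(n, q)) (r : nat) : Prop :=
  forall x0 d, (forall k, (k <= r)%N -> C *m state A G x0 d k = 0) ->
    x0 = 0 /\ forall k, (k < r)%N -> d k = 0.

(** This is the variation of constants formula, stacked over time. *)
Lemma mul_obsv_input_mx (R : realType) (c n q : nat) (C : 'M[R]_(c, n))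
    (A : 'M[R]_n) (G : 'M[R]_(n, q)) r (x0 : 'cV[R]_n) (d : nat -> 'cV[R]_q) :
  row_mx (obsv_mx C A r) (input_mx C A G r)
      *m col_mx x0 (\mxcol_(j < r) d j)
    = \mxcol_(i < r.+1) (C *m state A G x0 d i).
Proof.
rewrite mul_row_col /obsv_mx /input_mx mxcol_mul mul_mxblock_mxrow -mxcolD.
apply: eq_mxcol => i; rewrite state_sum mulmxDr mulmxA mulmx_sumr.
congr (_ + _).
(* the blocks on and above the diagonal vanish, and i <= r *)
rewrite (big_ord_widen r (fun j => C *m (A ^+ (i - j - 1) *m G *m d j))).
  rewrite [RHS]big_mkcond; apply: eq_bigr => j _.
  by case: ifP => _; rewrite ?mul0mx // !mulmxA.
by rewrite -ltnS.
Qed.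

Lemma obsv_input_full_rankP (R : realType) (c n q : nat) (C : 'M[R]_(c, n))
    (A : 'M[R]_n) (G : 'M[R]_(n, q)) r :
  \rank (row_mx (obsv_mx C A r) (input_mx C A G r)) = (n + r * q)%N
    <-> zero_output_trivial C A G r.
Proof.
have -> : (n + r * q = n + \sum_(j < r) q)%N by rewrite sum_nat_const card_ord.
rewrite full_col_rankP; split=> [inj x0 d y0 | triv v].
  have /inj/eqP : row_mx (obsv_mx C A r) (input_mx C A G r)
      *m col_mx x0 (\mxcol_(j < r) d j) = 0.
    rewrite mul_obsv_input_mx -[RHS]mxcol0; apply: eq_mxcol => i.
    by rewrite y0 // -ltnS.
  rewrite col_mx_eq0 => /andP[/eqP-> /eqP d0]; split=> // k ltkr.
  move/(congr1 (fun M => submxcol M (Ordinal ltkr))): d0.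
  by rewrite mxcolK /= => ->; apply/matrixP=> i j; rewrite !mxE.
rewrite -[v]vsubmxK -[dsubmx v]submxcolK.
set x0 := usubmx v; set e := submxcol (dsubmx v).
(* the values of [d] from time [r] on are irrelevant *)
pose d k := if insub k is Some j then e j else 0.
have -> : \mxcol_j e j = \mxcol_(j < r) d j.
  by apply: eq_mxcol => j; rewrite /d valK.
rewrite mul_obsv_input_mx => y0.
have [k lekr|-> d0] := triv x0 d.
  have ltkr : (k < r.+1)%N by [].
  move/(congr1 (fun M => submxcol M (Ordinal ltkr))): y0.
  by rewrite mxcolK /= => ->; apply/matrixP=> i j; rewrite !mxE.
apply/eqP; rewrite col_mx_eq0 eqxx -[X in _ == X]mxcol0; apply/eqP.
by apply: eq_mxcol => j; rewrite d0.
Qed.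

(** The property at [r], applied to a trajectory and to its tail, leaves only
    the first input undecided; as [x_0 = x_1 = 0], that input is in the kernel
    of [G]. *)
Lemma zero_output_trivialS (R : realType) (c n q : nat) (C : 'M[R]_(c, n))
    (A : 'M[R]_n) (G : 'M[R]_(n, q)) r :
    (forall v : 'cV_q, G *m v = 0 -> v = 0) ->
  zero_output_trivial C A G r -> zero_output_trivial C A G r.+1.
Proof.
move=> injG triv x0 d y0.
have [k lekr|x00 d0] := triv x0 d; first by apply: y0; apply: leqW.
have [k lekr|x10 dS0] := triv (A *m x0 + G *m d 0) (fun j => d j.+1).
  by rewrite -state_shift y0.
split=> // -[_|k]; last by rewrite ltnS; apply: dS0.
by apply: injG; rewrite -x10 x00 mulmx0 add0r.
Qed.

(** An input [v] with [C G v = 0], applied at the last instant from rest, yields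
    zero output. *)
Lemma zero_output_trivial_input_inj (R : realType) (c n q : nat)
    (C : 'M[R]_(c, n)) (A : 'M[R]_n) (G : 'M[R]_(n, q)) r :
  (0 < r)%N -> zero_output_trivial C A G r -> \rank (C *m G) = q.
Proof.
case: r => // r _ triv; apply/full_col_rankP => v CGv0.
(* the only nonzero input acts at the last instant [r] before the horizon *)
pose d k := if k == r then v else 0.
have x0 k : (k <= r)%N -> state A G 0 d k = 0.
  by move=> lekr; apply: state0 => j ltjk; rewrite /d ifN //; lia.
have [k|_ /(_ r)] := triv 0 d; last by rewrite /d eqxx; apply.
rewrite leq_eqVlt => /predU1P[->|ltkr]; last by rewrite x0 ?mulmx0.
by rewrite /= x0 // mulmx0 add0r /d eqxx mulmxA.
Qed.

(** Keeping the output at zero at the next step means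
    [C A x_k + C G d_k = 0], which a left inverse [L] of [C G] solves uniquely
    for [d_k]: the input is a state feedback and the trajectory is autonomous. *)
Lemma output_nulling_state (R : realType) (c n q : nat) (C : 'M[R]_(c, n))
    (A : 'M[R]_n) (G : 'M[R]_(n, q)) (L : 'M[R]_(q, c)) r x0 d :
    L *m (C *m G) = 1%:M ->
    (forall k, (k <= r)%N -> C *m state A G x0 d k = 0) ->
  forall k, (k <= r)%N ->
    state A G x0 d k = (A - G *m L *m C *m A) ^+ k *m x0.
Proof.
move=> LCG y0; elim=> [|k IHk] ltkr; first by rewrite expr0 mul1mx.
rewrite exprS -mulmxE -mulmxA -IHk ?(ltnW ltkr) //= mulmxBl; congr (_ + _).
have /(congr1 (mulmx L)) := y0 _ ltkr; rewrite /= mulmx0 !mulmxDr.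
rewrite !(mulmxA L) !(mulmxA (L *m C)) -(mulmxA L C G) LCG mul1mx => /eqP.
by rewrite addrC addr_eq0 => /eqP->; rewrite mulmxN !mulmxA.
Qed.

(** The feedback that nulls the output removes the quantification over inputs:
    the property becomes observability, over the horizon [r], of the autonomous
    closed-loop system. *)
Lemma zero_output_trivial_feedbackP (R : realType) (c n q : nat)
    (C : 'M[R]_(c, n)) (A : 'M[R]_n) (G : 'M[R]_(n, q)) (L : 'M[R]_(q, c)) r :
    L *m (C *m G) = 1%:M ->
  let F := A - G *m L *m C *m A in
  zero_output_trivial C A G r <->
    forall x : 'cV_n, (forall k, (k <= r)%N -> C *m F ^+ k *m x = 0) -> x = 0.
Proof.
move=> LCG F; split=> [triv x y0 | inj x0 d y0].
  pose d k := - (L *m C *m A *m F ^+ k *m x).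
  have stF k : state A G x d k = F ^+ k *m x.
    elim: k => [|k /= ->]; first by rewrite expr0 mul1mx.
    by rewrite exprS -mulmxE /d mulmxN -(mulmxA F) mulmxBl !mulmxA.
  by have [k lekr|] := triv x d; first by rewrite stF mulmxA y0.
have st k lekr := output_nulling_state LCG y0 (k := k) lekr.
have x00 : x0 = 0.
  by apply: inj => k lekr; rewrite -mulmxA -st // y0.
split=> // k ltkr; have := st k.+1 ltkr.
rewrite /= st ?(ltnW ltkr) // x00 !mulmx0 add0r => /(congr1 (mulmx (L *m C))).
by rewrite mulmx0 mulmxA -(mulmxA L) LCG mul1mx.
Qed.

(** * Cayley-Hamilton: [n] samples decide observability *)

Lemma observability_horizon (F : fieldType) (c n : nat) (C : 'M[F]_(c, n))
    (A : 'M[F]_n) (x : 'cV[F]_n) :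
    (forall k, (k < n)%N -> C *m A ^+ k *m x = 0) ->
  forall k, C *m A ^+ k *m x = 0.
Proof.
case: n => [|n] in C A x *; first by move=> _ k; rewrite (flatmx0 x) mulmx0.
move=> y0 k.
have hornerXn i : horner_mx A 'X^i = A ^+ i by rewrite rmorphXn /= horner_mx_X.
(* modulo the characteristic polynomial, [A ^+ k] has degree less than [n] *)
have -> : A ^+ k = horner_mx A ('X^k %% char_poly A).
  rewrite -hornerXn {1}(divp_eq 'X^k (char_poly A)) rmorphD rmorphM /=.
  by rewrite Cayley_Hamilton mulr0 add0r.
set r := _ %% _; rewrite -[r]coefK poly_def rmorph_sum mulmx_sumr mulmx_suml.
apply: big1 => i _.
rewrite /= horner_mxZ hornerXn -scalemxAr -scalemxAl y0 ?scaler0 //.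
apply: leq_trans (ltn_ord i) _; rewrite -ltnS -(size_char_poly A).
by rewrite ltn_modp monic_neq0 ?char_poly_monic.
Qed.

(** The order [n] of the system bounds the horizon that has to be examined,
    because after closing the loop only observability is at stake. *)
Lemma zero_output_trivial_horizon (R : realType) (c n q : nat)
    (C : 'M[R]_(c, n)) (A : 'M[R]_n) (G : 'M[R]_(n, q)) r :
  (0 < r)%N -> zero_output_trivial C A G r -> zero_output_trivial C A G n.
Proof.
move=> r_gt0 triv.
have [L LCG] := full_col_rank_linv (zero_output_trivial_input_inj r_gt0 triv).
apply/(zero_output_trivial_feedbackP _ _ LCG) => x y0.
apply: ((zero_output_trivial_feedbackP _ _ LCG).1 triv) => k _.
by apply: observability_horizon => j ltjn; apply/y0/ltnW.
Qed.

Lemma obsv_mx_full_rankP (R : realType) (c n : nat) (C : 'M[R]_(c, n))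
    (A : 'M[R]_n) r :
  \rank (obsv_mx C A r) = n <->
    forall x : 'cV_n, (forall k, (k <= r)%N -> C *m A ^+ k *m x = 0) -> x = 0.
Proof.
rewrite full_col_rankP /obsv_mx; split=> inj x y0; apply: inj.
  rewrite mxcol_mul -[RHS]mxcol0; apply: eq_mxcol => i.
  by rewrite y0 // -ltnS.
move=> k lekr; have ltkr : (k < r.+1)%N by [].
move/(congr1 (fun M => submxcol M (Ordinal ltkr))): y0.
by rewrite mxcol_mul mxcolK /= => ->; apply/matrixP=> i j; rewrite !mxE.
Qed.

Lemma zero_output_trivial_obsv (R : realType) (c n q : nat)
    (C : 'M[R]_(c, n)) (A : 'M[R]_n) (G : 'M[R]_(n, q)) r (x : 'cV[R]_n) :
    zero_output_trivial C A G r ->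
  (forall k, C *m A ^+ k *m x = 0) -> x = 0.
Proof.
move=> triv y0; have [k _|//] := triv x (fun=> 0).
rewrite state_sum big1 ?addr0 ?mulmxA ?y0 // => j _.
by rewrite mulmx0.
Qed.

(** * Decoupling the two components of the unknown input *)

Lemma unitary_colsE (R : realType) (m a b : nat)
    (X1 : 'M[R]_(m, a)) (X2 : 'M[R]_(m, b)) :
    unitary_cols X1 X2 ->
  [/\ X1^T *m X1 = 1%:M, X1^T *m X2 = 0, X2^T *m X1 = 0, X2^T *m X2 = 1%:M
    & X1 *m X1^T + X2 *m X2^T = 1%:M].
Proof.
case; rewrite tr_row_mx mul_row_col mul_col_row scalar_mx_block.
by move=> /eq_block_mx[-> -> -> ->] ->.
Qed.

Lemma svd_thin (R : realType) (l p : nat) (H : 'M[R]_(l, p))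
    (U1 : 'M[R]_(l, \rank H)) (U2 : 'M[R]_(l, l - \rank H))
    (S : 'M[R]_(\rank H))
    (V1 : 'M[R]_(p, \rank H)) (V2 : 'M[R]_(p, p - \rank H)) :
  is_svd U1 U2 S V1 V2 -> H = U1 *m S *m V1^T.
Proof.
case=> _ _ _ _ {1}->; rewrite -mulmxA mul_block_col !mul0mx !addr0 mul_row_col.
by rewrite mulmx0 addr0 mulmxA.
Qed.

Lemma svd_unit (R : realType) (l p : nat) (H : 'M[R]_(l, p))
    (U1 : 'M[R]_(l, \rank H)) (U2 : 'M[R]_(l, l - \rank H))
    (S : 'M[R]_(\rank H))
    (V1 : 'M[R]_(p, \rank H)) (V2 : 'M[R]_(p, p - \rank H)) :
  is_svd U1 U2 S V1 V2 -> S \in unitmx.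
Proof. by case=> _ _ _ rkS _; rewrite -row_free_unit /row_free rkS. Qed.

Lemma mul_decoupling_mx (R : realType) (l a b : nat) (Rv : 'M[R]_l)
    (U1 : 'M[R]_(l, a)) (U2 : 'M[R]_(l, b)) :
  unitary_cols U1 U2 -> decoupling_mx Rv U1 U2 *m U1 = 1%:M.
Proof.
move=> /unitary_colsE[U11 _ U21 _ _].
by rewrite /decoupling_mx mulmxBl U11 -[X in _ - X]mulmxA U21 mulmx0 subr0.
Qed.

(** The rows of [T1] and [U2^T] together are invertible: [T1] differs from
    [U1^T] by a left multiple of [U2^T]. *)
Lemma decoupled_eq0 (R : realType) (l a b : nat) (Rv : 'M[R]_l)
    (U1 : 'M[R]_(l, a)) (U2 : 'M[R]_(l, b)) (y : 'cV[R]_l) :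
    unitary_cols U1 U2 ->
  decoupling_mx Rv U1 U2 *m y = 0 -> U2^T *m y = 0 -> y = 0.
Proof.
move=> /unitary_colsE[_ _ _ _ UU1] T1y U2y; move: T1y.
rewrite /decoupling_mx mulmxBl -[X in _ - X]mulmxA U2y mulmx0 subr0 => U1y.
by rewrite -[y]mul1mx -UU1 mulmxDl -!mulmxA U1y U2y !mulmx0 addr0.
Qed.

(** [T1 H = Sigma V1^T] and [U2^T H = 0], so the invertible output transformation
    by [T1] and [U2^T] separates a constraint on the state from an equation that
    determines [V1^T d]. *)
Lemma output_eq0P (R : realType) (n l p : nat) (C : 'M[R]_(l, n))
    (H : 'M[R]_(l, p)) (Rv : 'M[R]_l)
    (U1 : 'M[R]_(l, \rank H)) (U2 : 'M[R]_(l, l - \rank H))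
    (S : 'M[R]_(\rank H))
    (V1 : 'M[R]_(p, \rank H)) (V2 : 'M[R]_(p, p - \rank H))
    (x : 'cV[R]_n) (d : 'cV[R]_p) :
    is_svd U1 U2 S V1 V2 ->
  C *m x + H *m d = 0 <->
    U2^T *m C *m x = 0 /\
    V1^T *m d = - (invmx S *m (decoupling_mx Rv U1 U2 *m C) *m x).
Proof.
move=> svdH; have Suni := svd_unit svdH; have HE := svd_thin svdH.
have [unitU _ _ _ _] := svdH.
have T1H : decoupling_mx Rv U1 U2 *m H = S *m V1^T.
  by rewrite (congr1 (mulmx _) HE) !mulmxA mul_decoupling_mx // mul1mx.
have U2H : U2^T *m H = 0.
  have [_ _ U21 _ _] := unitary_colsE unitU.
  by rewrite (congr1 (mulmx _) HE) !mulmxA U21 !mul0mx.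
split=> [y0 | [U2y d1]].
  split.
    have := congr1 (mulmx U2^T) y0.
    by rewrite mulmxDr mulmx0 !mulmxA U2H mul0mx addr0.
  have /eqP := congr1 (mulmx (decoupling_mx Rv U1 U2)) y0.
  rewrite mulmxDr mulmx0 !mulmxA T1H addrC addr_eq0 => /eqP.
  by move/(congr1 (mulmx (invmx S))); rewrite -mulmxA mulKmx // mulmxN !mulmxA.
apply: (decoupled_eq0 (Rv := Rv) unitU); rewrite mulmxDr !mulmxA.
  by rewrite T1H -(mulmxA S) d1 mulmxN !mulmxA mulmxV // mul1mx subrr.
by rewrite U2y U2H mul0mx addr0.
Qed.

(** A component [V1^T d] that is a function of the state is absorbed into the
    dynamics; only [V2^T d] remains an input. *)
Lemma decoupled_state (R : realType) (n p a b : nat) (A K : 'M[R]_n)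
    (G : 'M[R]_(n, p)) (V1 : 'M[R]_(p, a)) (V2 : 'M[R]_(p, b))
    (N : 'M[R]_(a, n)) (x0 : 'cV[R]_n) (d : nat -> 'cV[R]_p) k :
    unitary_cols V1 V2 ->
    (forall j, (j < k)%N -> V1^T *m d j = - (N *m state A G x0 d j)) ->
  state A G x0 d k
    = state (A - G *m V1 *m N) (G *m V2) x0 (fun j => V2^T *m d j) k.
Proof.
move=> /unitary_colsE[_ _ _ _ VV1]; elim: k => //= k IHk d1.
rewrite -IHk; last by move=> j /ltnW; apply: d1.
rewrite -[in LHS](mul1mx (d k)) -VV1 mulmxDl -(mulmxA V1) d1 // mulmxDr.
by rewrite !mulmxN mulmxBl !mulmxA addrA.
Qed.

(** Linearity reduces uniqueness to the zero output, and trajectories with zero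
    output of the two systems correspond to each other: from [d] keep
    [V2^T d], and conversely let [V1^T d] take the value that cancels the
    transformed output. *)
Lemma strongly_observableP (R : realType) (n l p : nat) (A : 'M[R]_n)
    (G : 'M[R]_(n, p)) (C : 'M[R]_(l, n)) (H : 'M[R]_(l, p)) (Rv : 'M[R]_l)
    (U1 : 'M[R]_(l, \rank H)) (U2 : 'M[R]_(l, l - \rank H))
    (S : 'M[R]_(\rank H))
    (V1 : 'M[R]_(p, \rank H)) (V2 : 'M[R]_(p, p - \rank H)) :
    is_svd U1 U2 S V1 V2 ->
  let Ahat := A - G *m V1 *m invmx S *m (decoupling_mx Rv U1 U2 *m C) in
  strongly_observable A G C H V1 V2 <->
    exists r0', forall r, (r0' <= r)%N ->
      zero_output_trivial (U2^T *m C) Ahat (G *m V2) r.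
Proof.
move=> svdH Ahat; have [_ unitV _ _ _] := svdH.
pose N := invmx S *m (decoupling_mx Rv U1 U2 *m C).
have AhatE : Ahat = A - G *m V1 *m N by rewrite /Ahat /N !mulmxA.
split=> -[r0' sobs]; exists r0' => r /sobs {}sobs.
  move=> x0 d2 y0; pose x k := state Ahat (G *m V2) x0 d2 k.
  have [V11 V12 V21 V22 _] := unitary_colsE unitV.
  pose d k := V2 *m d2 k - V1 *m (N *m x k).
  have V1d k : V1^T *m d k = - (N *m x k).
    by rewrite mulmxBr !(mulmxA V1^T) V12 V11 mul0mx mul1mx add0r.
  have V2d k : V2^T *m d k = d2 k.
    by rewrite mulmxBr !mulmxA V22 V21 !mul0mx mul1mx subr0.
  have xE k : state A G x0 d k = x k.
    elim: k => //= k ->; rewrite -[RHS]/(Ahat *m x k + G *m V2 *m d2 k).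
    by rewrite /d AhatE mulmxBr mulmxBl !mulmxA addrA addrAC.
  (* compare with the trajectory at rest *)
  have [k lekr|-> _ d20] := sobs x0 0 d (fun=> 0).
    rewrite /output state0 // !mulmx0 addr0 xE.
    by apply/(output_eq0P _ Rv _ _ svdH); rewrite V1d /x y0.
  by split=> // k ltkr; rewrite -V2d d20 // mulmx0.
move=> x0 x0' d d' eqy; pose e j := d j - d' j.
have y0 k : (k <= r)%N -> C *m state A G (x0 - x0') e k + H *m e k = 0.
  move=> lekr; rewrite stateB !mulmxBr addrACA -opprD.
  by rewrite -!/(output _ _ _ _ _ _ _) eqy // subrr.
have U2y k lekr := ((output_eq0P _ Rv _ _ svdH).1 (y0 k lekr)).1.
have V1e k lekr := ((output_eq0P _ Rv _ _ svdH).1 (y0 k lekr)).2.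
have stE k : (k <= r)%N -> state A G (x0 - x0') e k
    = state Ahat (G *m V2) (x0 - x0') (fun j => V2^T *m e j) k.
  move=> lekr; rewrite AhatE; apply: decoupled_state => // j ltjk.
  by apply/V1e/ltnW/(leq_trans ltjk).
have [k lekr|xx0 e20] := sobs (x0 - x0') (fun j => V2^T *m e j).
  by rewrite -stE // U2y.
split; first exact/subr0_eq.
  move=> k lekr; apply/eqP; rewrite -subr_eq0 -mulmxBr V1e // stE // xx0.
  by rewrite state0 ?mulmx0 ?oppr0 // => j ltjk; apply/e20/(leq_trans ltjk).
by move=> k ltkr; apply/eqP; rewrite -subr_eq0 -mulmxBr e20.
Qed.

(** Inputs of the form [V2 v] are invisible to [H], so they must be visible
    to [G]. *)
Lemma undetected_input_inj (R : realType) (n l p : nat) (G : 'M[R]_(n, p))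
    (H : 'M[R]_(l, p)) (U1 : 'M[R]_(l, \rank H)) (U2 : 'M[R]_(l, l - \rank H))
    (S : 'M[R]_(\rank H))
    (V1 : 'M[R]_(p, \rank H)) (V2 : 'M[R]_(p, p - \rank H))
    (v : 'cV[R]_(p - \rank H)) :
    \rank (row_mx G^T H^T) = p -> is_svd U1 U2 S V1 V2 ->
  G *m V2 *m v = 0 -> v = 0.
Proof.
rewrite -tr_col_mx mxrank_tr => /full_col_rankP injGH svdH GV2v0.
have [_ /unitary_colsE[_ V12 _ V22 _] _ _ _] := svdH.
rewrite -[v]mul1mx -V22 -mulmxA (injGH (V2 *m v)) ?mulmx0 //.
rewrite mul_col_mx mulmxA GV2v0 (congr1 (mulmx^~ _) (svd_thin svdH)) /=.
by rewrite -(mulmxA (U1 *m S)) (mulmxA V1^T) V12 mul0mx mulmx0 col_mx0.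
Qed.

(** * Counting equations *)

Lemma obsv_input_rank_size (R : realType) (c n q : nat) (C : 'M[R]_(c, n))
    (A : 'M[R]_n) (G : 'M[R]_(n, q)) r :
    \rank (row_mx (obsv_mx C A r) (input_mx C A G r)) = (n + r * q)%N ->
  (n + r * q <= r.+1 * c)%N.
Proof.
by move=> <-; apply: leq_trans (rank_leq_row _) _; rewrite sum_nat_const card_ord.
Qed.

(** The count of rows gives [n - l + h <= r (l - p)], which is stronger by [2 h]
    than the bound needed here. *)
Lemma horizon_lower_bound (n l p h r : nat) :
    (h <= p)%N -> (p < l)%N -> (n + r * (p - h) <= r.+1 * (l - h))%N ->
  Num.ceil ((n%:R - l%:R - h%:R) / (l%:R - p%:R) : rat) <= r%:Z.
Proof.
move=> lehp ltpl rows.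
rewrite ceil_le_int ler_pdivrMr ?subr_gt0 ?ltr_nat // -pmulrn.
have : (n + r * p <= r * l + l + h)%N by nia.
by rewrite -(ler_nat rat) !natrD !natrM; lra.
Qed.

Theorem theorem3 (R : realType) (n l p : nat)
    (A : 'M[R]_n) (G : 'M[R]_(n, p)) (C : 'M[R]_(l, n)) (H : 'M[R]_(l, p))
    (Rv : 'M[R]_l)
    (U1 : 'M[R]_(l, \rank H)) (U2 : 'M[R]_(l, l - \rank H))
    (Sigma : 'M[R]_(\rank H))
    (V1 : 'M[R]_(p, \rank H)) (V2 : 'M[R]_(p, p - \rank H))
    (hl : (1 <= l)%N) (hln : (l <= n)%N) (hpl : (p <= l)%N)
    (hGH : \rank (row_mx G^T H^T) = p)
    (hRv : posdefmx Rv)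
    (hsvd : is_svd U1 U2 Sigma V1 V2) :
  let pH := \rank H in
  let G1 := G *m V1 in
  let G2 := G *m V2 in
  let C1 := decoupling_mx Rv U1 U2 *m C in
  let C2 := U2^T *m C in
  let Ahat := A - G1 *m invmx Sigma *m C1 in
  let rank_cond (nt : nat) : Prop :=
    \rank (row_mx (obsv_mx C2 Ahat nt) (input_mx C2 Ahat G2 nt))
      = (n + nt * (p - pH))%N in
  let r0 : int :=
    Num.ceil ((n%:R - l%:R - pH%:R) / (l%:R - p%:R) : rat) in
  [/\ strongly_observable A G C H V1 V2 <->
        (exists nt : nat, (nt <= n)%N /\ rank_cond nt),
      (forall nt : nat, (nt <= n)%N -> rank_cond nt ->
         (l <> p -> (r0 <= nt%:Z) /\ (nt <= n)%N) /\
         (l = p -> [/\ l = p, p = n & pH = 0%N]))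
    & (rank_cond n ->
         [/\ ((r0 <= n%:Z) /\ (p + 1 <= l)%N) \/ [/\ l = p, p = n & pH = 0%N],
             \rank (obsv_mx C2 Ahat n.-1) = n /\ observable Ahat C
           & \rank (C2 *m G2) = (p - pH)%N /\ (p - pH <= \rank (C *m G))%N])].
Proof.
move=> pH G1 G2 C1 C2 Ahat rank_cond r0.
have lepHp : (pH <= p)%N := rank_leq_col H.
have n_gt0 : (0 < n)%N by apply: leq_trans hln.
have condP nt : rank_cond nt <-> zero_output_trivial C2 Ahat G2 nt.
  exact: obsv_input_full_rankP.
have injG2 (v : 'cV_(p - pH)) : G2 *m v = 0 -> v = 0.
  exact: undetected_input_inj hGH hsvd.
have horizon nt : rank_cond nt ->
    (l <> p -> (r0 <= nt%:Z)) /\ (l = p -> [/\ l = p, p = n & pH = 0%N]).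
  move=> /obsv_input_rank_size rows; split=> [/eqP nelp | eqlp].
    by apply: horizon_lower_bound rows => //; rewrite ltn_neqAle eq_sym nelp.
  by move: rows; rewrite -/pH; split; nia.
split.
- rewrite (strongly_observableP _ _ _ Rv hsvd); split=> [[r0' sobs] | [nt [_ cond]]].
    (* any positive horizon will do; [r0'] itself may be zero *)
    exists n; split=> //; apply/condP.
    by apply: (zero_output_trivial_horizon (r := r0'.+1)) => //; apply: sobs.
  (* the property persists at all horizons beyond [nt] *)
  exists nt => r /subnK <-; elim: (r - nt)%N => [|k IHk]; first exact/condP.
  exact: zero_output_trivialS.
- by move=> nt lentn /horizon[bound square]; split=> [/bound|/square].
move=> cond; have [bound square] := horizon n cond.
have triv := (condP n).1 cond.
split.
- have [eqlp | nelp] := eqVneq l p; [right; exact: square | left].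
  by split; [exact/bound/eqP | rewrite addn1 ltn_neqAle eq_sym nelp].
- split.
    apply/obsv_mx_full_rankP => x y0; apply: (zero_output_trivial_obsv triv).
    by apply: observability_horizon => k ltkn; apply: y0; rewrite -ltnS prednK.
  exists n => x x' eqy; apply/subr0_eq/(zero_output_trivial_obsv triv).
  apply: observability_horizon => k ltkn; rewrite /C2 -!mulmxA mulmxA.
  by rewrite -mulmxA (mulmxA C) mulmxBr eqy ?subrr ?mulmx0 // ltnW.
have rkCG : \rank (C2 *m G2) = (p - pH)%N.
  exact: zero_output_trivial_input_inj n_gt0 triv.
split=> //; rewrite -rkCG /C2 /G2 !mulmxA.
apply: leq_trans (mxrankM_maxl _ _) _; rewrite -mulmxA; exact: mxrankM_maxr.
Qed.
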